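(* Let $\beta, \beta' > 1$ be real numbers, let $a_1 a_2 \cdots$ be the $(-\beta)$-expansion of $\frac{-\beta}{\beta+1}$ and let $a'_1 a'_2 \cdots$ be the $(-\beta')$-expansion of $\frac{-\beta'}{\beta'+1}$. Then $\beta < \beta'$ if and only if $a_1 a_2 \cdots <_{\mathrm{alt}} a'_1 a'_2 \cdots$.
   Context: For real $\beta > 1$, the $(-\beta)$-transformation is $$T_{-\beta}:\ \left[\tfrac{-\beta}{\beta+1}, \tfrac{1}{\beta+1}\right) \to \left[\tfrac{-\beta}{\beta+1}, \tfrac{1}{\beta+1}\right),\quad x \mapsto -\beta x - \left\lfloor \tfrac{\beta}{\beta+1} - \beta x \right\rfloor,$$ and the $(-\beta)$-expansion of $x \in \left[\frac{-\beta}{\beta+1}, \frac{1}{\beta+1}\right)$ is the digit sequence $\varepsilon_1(x)\varepsilon_2(x)\cdots$ with $\varepsilon_n(x) = \left\lfloor \tfrac{\beta}{\beta+1} - \beta\, T_{-\beta}^{n-1}(x) \right\rfloor$; it satisfies $x = \sum_{n\ge 1} \varepsilon_n(x)/(-\beta)^n$. The alternating lexicographic order on infinite sequences of integers is defined as follows: if $x_1 \cdots x_{k-1} = y_1 \cdots y_{k-1}$ and $x_k \ne y_k$, then $x_1 x_2 \cdots <_{\mathrm{alt}} y_1 y_2 \cdots$ if and only if $x_k < y_k$ when $k$ is odd, and $y_k < x_k$ when $k$ is even. *)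

(* Defs.v *)
From HB Require Import structures.
From mathcomp Require Import all_boot all_order all_algebra.
From mathcomp Require Import reals.
Set Implicit Arguments.
Unset Strict Implicit.
Unset Printing Implicit Defensive.

Import Order.TTheory GRing.Theory Num.Theory.
Local Open Scope ring_scope.

Definition negbeta_domain (R : realType) (beta : R) : interval R :=
  `[- beta / (beta + 1), 1 / (beta + 1)[.

(* Total on R; the transformation proper is its restriction to
   [negbeta_domain beta], which it preserves ([negbetaT_domain]). *)
Definition negbetaT (R : realType) (beta x : R) : R :=
  - beta * x - (Num.floor (beta / (beta + 1) - beta * x))%:~R.

(* Sequences are indexed from 0, so [negbeta_expansion beta x n] is the digit
   epsilon_(n+1)(x). *)
Definition negbeta_expansion (R : realType) (beta x : R) : nat -> int :=
  fun n => Num.floor (beta / (beta + 1) - beta * iter n (negbetaT beta) x).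

(* Index k is the (k+1)-st term, hence the parity test on k.+1. *)
Definition alt_lt (x y : nat -> int) : Prop :=
  exists k : nat,
    (forall i : nat, (i < k)%N -> x i = y i) /\
    (if odd k.+1 then x k < y k else y k < x k).

Lemma negbetaT_domain (R : realType) (beta x : R) :
  1 < beta -> x \in negbeta_domain beta ->
  negbetaT beta x \in negbeta_domain beta.
Proof.
move=> b1 _; rewrite /negbeta_domain /negbetaT in_itv /=.
have b0 : beta + 1 != 0 by rewrite gt_eqF // addr_gt0 // (lt_trans _ b1).
set y := beta / (beta + 1) - beta * x.
have -> : - beta * x = y - beta / (beta + 1) by rewrite /y addrAC subrr add0r mulNr.
have -> : 1 / (beta + 1) = 1 - beta / (beta + 1).
  by rewrite -[X in _ = X - _](divff b0) -mulrBl addrAC subrr add0r.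
have /andP[h1 h2] := floor_itv y.
rewrite addrAC mulNr lerDr ltrD2r subr_ge0 h1 /=.
by rewrite ltrBlDr addrC -(intrD R _ 1).
Qed.

Lemma negbeta_left_endpoint (R : realType) (beta : R) :
  1 < beta -> - beta / (beta + 1) \in negbeta_domain beta.
Proof.
move=> b1; have b0 : 0 < beta by rewrite (lt_trans _ b1).
rewrite /negbeta_domain in_itv /= lexx /= ltr_pM2r ?invr_gt0 ?addr_gt0 //.
by rewrite (lt_trans _ (@ltr01 R)) // oppr_lt0.
Qed.

(* Main.v *)
Require Import Defs.
From mathcomp Require Import all_boot all_order all_algebra.
From mathcomp Require Import boolp classical_sets reals topology normedtype sequences.
From mathcomp Require Import lra ring zify.
Import Order.TTheory GRing.Theory Num.Theory.
Local Open Scope ring_scope.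

(** The substitution [x = 1 / (beta + 1) - y] turns the transformation into
    [y |-> 1 + floor (beta y) - beta y] on the interval from 0 (excluded) to 1
    (included), with digits [floor (beta y)]; the left endpoint becomes [y = 1],
    and the alternating order on digit sequences becomes the usual order on
    points.  Write [a] and [a'] for the digit sequences of 1 in bases [beta] and
    [beta'].

    A power series comparison as for positive bases fails because the signs
    alternate.  Instead [beta] is recovered as a growth rate: the number of
    words of [n] digits that occur in expansions in base [-beta] is of
    exponential order [beta ^ n].  It therefore suffices that a weak inequality
    between [a] and [a'] gives an inclusion between these sets of words: this is
    [le_of_alt_le].  The strict equivalence follows formally, since the
    alternating order is total and equal bases have equal sequences.

    Inclusion.  Suppose [a <= a'].  Every sequence produced in base [-beta] has
    nonnegative digits, and all its shifts are at most [a], hence at most [a'].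
    Reading such a sequence in base [-beta'] defines [transfer].  Comparing a
    sequence with [a'] at the first place where they differ improves any bound
    [1 + beta' * e] on all values to [1 + e] ([transfer_le_step]), so [transfer]
    takes values between 0 and 1 ([transfer_itv]).  The value 0 would be a failure: 0 is not
    in the domain, and the digits read would not be those of an expansion.  It
    is excluded by expansion: a point [u] sent to 0 produces another such point
    at least [beta] times as large ([transfer_zero_step]).  Hence [transfer]
    commutes with the two maps and preserves digits.

    Counting.  Two points with the same first [n] digits are at distance less
    than [beta ^ - n], so there are at least [beta ^ n - 1] words of length [n]
    ([grid_words]).  Conversely, [m] digits are determined away from finitely
    many breakpoints; so for fixed [m] there is [e > 0] such that among four
    increasing points spanning less than [e], two neighbours have the same [m]
    digits.  This makes the number of words at most triple, up to a term of
    order [beta ^ n], when [m] digits are appended to words of length [n]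
    ([words_le_rec]).  As [m] is arbitrary, the factor 3 per [m] steps is
    harmless, and the number of words is at most of order [r ^ n] for each
    [r > beta] ([words_le_exp]). *)

Set Implicit Arguments.
Unset Strict Implicit.

(** * The alternating order *)

(** Stated without choosing a first difference: every common prefix constrains
    the next letter.  It is the negation of the reversed [alt_lt]. *)
Definition alt_le (x y : nat -> int) : Prop :=
  forall k, (forall i, (i < k)%N -> x i = y i) ->
    if odd k.+1 then x k <= y k else y k <= x k.

Lemma alt_ltW x y : alt_lt x y -> alt_le x y.
Proof.
move=> [k [agree lt_k]] l agree_l.
have [lt_kl|lt_lk|<-] := ltngtP k l.
- by move: lt_k; rewrite agree_l //; case: ifP; rewrite ltxx.
- by rewrite agree //; case: ifP.
by move: lt_k; case: ifP => _; exact: ltW.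
Qed.

Lemma alt_lt_irr x : ~ alt_lt x x.
Proof. by case=> k [_]; case: ifP; rewrite ltxx. Qed.

Lemma alt_leNgt x y : ~ alt_lt x y -> alt_le y x.
Proof.
move=> nlt k agree.
have: ~~ (if odd k.+1 then x k < y k else y k < x k).
  by apply/negP => lt_k; apply: nlt; exists k; split=> // i /agree.
by case: ifP => _; rewrite -leNgt.
Qed.

(** The order is lexicographic, so prefixes are order-convex. *)
Lemma alt_le_sandwich x y z n : alt_le x y -> alt_le y z ->
  (forall i, (i < n)%N -> x i = z i) -> forall i, (i < n)%N -> y i = x i.
Proof.
move=> xy yz xz; elim/ltn_ind => i IH lt_in.
have yx k : (k < i)%N -> y k = x k by move=> lt_ki; apply: IH => //; lia.
have := xy i; have := yz i.
have -> // := xz i lt_in.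
move=> /(_ _) h1 /(_ _) h2.
have {h1} := h1 _; have {h2} := h2 _.
move=> h2 h1.
have {}h2 := h2 (fun k lt => esym (yx k lt)).
have {}h1 := h1 (fun k lt => etrans (yx k lt) (xz k (ltn_trans lt lt_in))).
by apply/eqP; rewrite eq_le; move: h1 h2; case: ifP => _ -> ->.
Qed.

Lemma alt_le_trans y x z : alt_le x y -> alt_le y z -> alt_le x z.
Proof.
move=> xy yz k xz.
have yx := alt_le_sandwich xy yz xz.
have := xy k (fun i lt => esym (yx i lt)).
have := yz k (fun i lt => etrans (yx i lt) (xz i lt)).
by case: ifP => _ h1 h2; [exact: le_trans h2 h1|exact: le_trans h1 h2].
Qed.

(** Removing a common prefix of odd length exchanges the parities of the
    remaining positions, which reverses the order. *)
Lemma alt_le_shift_odd x y n : odd n -> alt_le x y ->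
  (forall i, (i < n)%N -> x i = y i) ->
  alt_le (fun k => y (n + k)%N) (fun k => x (n + k)%N).
Proof.
move=> odd_n xy agree k agree_k.
have := xy (n + k)%N; rewrite -addnS oddD odd_n /=.
case: (odd k) => /=; apply=> i lt_i.
all: have [/agree //|le_ni] := ltnP i n.
all: by rewrite -(subnKC le_ni) agree_k //; lia.
Qed.

Lemma first_difference (u v : nat -> int) :
  u =1 v \/ exists2 j, (forall i, (i < j)%N -> u i = v i) & u j <> v j.
Proof.
case: (pselect (exists j, u j != v j)) => [exj|all_eq]; last first.
  by left=> j; apply/eqP/negP => /negP ne; apply: all_eq; exists j.
right; case: (ex_minnP exj) => k /eqP ne_k min_k; exists k => // i lt_ik.
by apply/eqP; apply: contraTT lt_ik => /min_k; rewrite -leqNgt.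
Qed.

(** * The transformation in the flipped coordinate *)

Section Dynamics.
Variable R : realType.
Implicit Types (b y z : R) (v : nat -> int) (x : nat -> R) (n k : nat).

Definition digit b y : int := Num.floor (b * y).
Definition flipmap b y : R := 1 + (digit b y)%:~R - b * y.
Definition itin b y n : int := digit b (iter n (flipmap b) y).

Lemma digit_itv b y : (digit b y)%:~R <= b * y < (digit b y)%:~R + 1.
Proof. by have := floor_itv (b * y); rewrite intrD. Qed.

Lemma digit_unique b y (d : int) :
  d%:~R <= b * y -> b * y < d%:~R + 1 -> digit b y = d.
Proof. by move=> h1 h2; apply: floor_def; rewrite h1 intrD. Qed.

Lemma intr_lt_addr1 (d e : int) : d < e -> d%:~R + 1 <= e%:~R :> R.
Proof.
by move=> de; have -> : d%:~R + 1 = (d + 1)%:~R :> R; [rewrite intrD|rewrite ler_int; lia].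
Qed.

Lemma flipmap_itv b y : 0 < flipmap b y <= 1.
Proof. by rewrite /flipmap; have := digit_itv b y; lra. Qed.

Lemma iter_flipmap_itv b y n :
  0 < y <= 1 -> 0 < iter n (flipmap b) y <= 1.
Proof. by case: n => //= n _; exact: flipmap_itv. Qed.

Lemma digit_ge0 b y : 0 < b -> 0 < y -> 0 <= digit b y.
Proof. by move=> b0 y0; rewrite /digit floor_ge0 mulr_ge0 ?ltW. Qed.

Lemma digit_mono b : 0 < b -> {homo digit b : y z / y <= z}.
Proof. by move=> b0 y z yz; apply: le_floor; rewrite ler_pM2l. Qed.

Lemma itinD b y n k : itin b y (n + k) = itin b (iter n (flipmap b) y) k.
Proof. by rewrite /itin addnC iterD. Qed.

(** The relation between consecutive points of an orbit, without the constraint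
    that the digit be the integer part.  It is thus satisfied also by the
    values of tails of sequences read in a foreign base. *)
Definition follows b v x : Prop :=
  forall n, x n.+1 = 1 + (v n)%:~R - b * x n.

Lemma orbit_follows b y : follows b (itin b y) (fun n => iter n (flipmap b) y).
Proof. by []. Qed.

Lemma follows_diff b v v' x x' n : follows b v x -> follows b v' x' ->
  (forall i, (i < n)%N -> v i = v' i) ->
  x n - x' n = (- b) ^+ n * (x 0 - x' 0).
Proof.
move=> fx fx'; elim: n => [|n IH] agree; first by rewrite expr0 mul1r.
rewrite fx fx' agree // exprS -mulrA -IH; last by move=> i lt; apply: agree; lia.
ring.
Qed.

Lemma exp_unbounded b c : 1 < b -> exists n, c < b ^+ n.
Proof.
move=> b1.
have step n : 1 + n%:R * (b - 1) <= b ^+ n.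
  elim: n => [|n IH]; first by rewrite mul0r addr0 expr0.
  rewrite exprS -natr1; have n0 : 0 <= n%:R :> R := ler0n _ _.
  have : b * (1 + n%:R * (b - 1)) <= b * b ^+ n by rewrite ler_pM2l //; lra.
  have : 0 <= n%:R * (b - 1) ^+ 2 by rewrite mulr_ge0 // sqr_ge0.
  rewrite expr2; lra.
have /archi_boundP h : 0 <= `|c| / (b - 1) by rewrite divr_ge0 //; lra.
exists (Num.bound (`|c| / (b - 1))).
apply: lt_le_trans (step _).
move: h; rewrite ltr_pdivrMr; last lra.
have := ler_norm c; lra.
Qed.

(** Differences grow like [b ^ n], so only one starting point stays bounded. *)
Lemma follows_unique b v v' x x' c : 1 < b ->
  follows b v x -> follows b v' x' -> v =1 v' ->
  (forall n, `|x n - x' n| <= c) -> x 0 = x' 0.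
Proof.
move=> b1 fx fx' vv' bd; apply/eqP; rewrite -subr_eq0; apply/negPn/negP => ne.
have e0 : 0 < `|x 0 - x' 0| by rewrite normr_gt0.
have [n hn] := exp_unbounded (c / `|x 0 - x' 0|) b1.
have := bd n; rewrite (follows_diff fx fx') => [|i _]; last exact: vv'.
rewrite normrM normrX normrN (ger0_norm (_ : 0 <= b)); last lra.
by rewrite leNgt -ltr_pdivrMr // hn.
Qed.

(** At the first different digit, position [k], the map has been applied [k]
    times, hence has reversed the order of the points [k] times; this is the
    parity rule of the alternating order. *)
Lemma itin_mono b y z : 0 < b -> y <= z -> alt_le (itin b y) (itin b z).
Proof.
move=> b0 yz k agree; rewrite /= /itin.
have := follows_diff (orbit_follows b y) (orbit_follows b z) agree.
rewrite /= exprNn -signr_odd.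
have p0 : 0 <= b ^+ k * (z - y) by rewrite mulr_ge0 ?subr_ge0 // exprn_ge0 // ltW.
case: odd => /= e; apply: digit_mono => //; move: e p0;
  rewrite ?expr1 ?expr0 ?mul1r ?mulN1r ?mulNr !mulrBr; lra.
Qed.

Lemma itin_inj b y z : 1 < b -> 0 < y <= 1 -> 0 < z <= 1 ->
  itin b y =1 itin b z -> y = z.
Proof.
move=> b1 hy hz eq.
apply: (follows_unique (c := 1) b1 (orbit_follows b y) (orbit_follows b z) eq).
move=> n; have := iter_flipmap_itv b n hy; have := iter_flipmap_itv b n hz.
by rewrite ler_norml; lra.
Qed.

Lemma negbetaT_conj b y : b + 1 != 0 ->
  negbetaT b (1 / (b + 1) - y) = 1 / (b + 1) - flipmap b y.
Proof.
move=> b1; rewrite /negbetaT /flipmap /digit.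
have -> : b / (b + 1) - b * (1 / (b + 1) - y) = b * y by field.
by field.
Qed.

Lemma negbeta_expansion_itin b : 1 < b ->
  negbeta_expansion b (- b / (b + 1)) =1 itin b 1.
Proof.
move=> b1 n; rewrite /negbeta_expansion /itin /digit.
have nz : b + 1 != 0 by rewrite gt_eqF //; lra.
have -> : iter n (negbetaT b) (- b / (b + 1)) =
          1 / (b + 1) - iter n (flipmap b) 1.
  elim: n => [|n IH] /=; first by field.
  by rewrite IH negbetaT_conj.
by congr Num.floor; field.
Qed.


Import numFieldNormedType.Exports.
Local Open Scope classical_set_scope.

(** The series solves the recurrence [y = (1 + v 0 - y') / b] backwards, where
    [y'] is the point reached after the digit [v 0]. *)
Definition value_term b v n : R := (1 + (v n)%:~R) / b * (- b^-1) ^+ n.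
Definition value b v : R := limn (series (value_term b v)).

Section Value.
Variables (b : R) (D : int).

Let bound n := geometric ((1 + D%:~R) / b) b^-1 n.

Lemma value_bound_cvg : 1 < b -> cvgn (series bound).
Proof.
move=> b1; apply: is_cvg_geometric_series.
have bV : 0 < b^-1 by rewrite invr_gt0 (lt_trans ltr01).
by rewrite ger0_norm ?ltW // invf_lt1; lra.
Qed.

Lemma value_term_le v n : 1 < b -> 0 <= v n <= D -> `|value_term b v n| <= bound n.
Proof.
move=> b1 /andP[v0 vD]; have vR : 0 <= (v n)%:~R :> R by rewrite ler0z.
have vDR : (v n)%:~R <= D%:~R :> R by rewrite ler_int.
have bV : 0 < b^-1 by rewrite invr_gt0 (lt_trans ltr01).
rewrite /value_term /bound /= !normrM normrX normrN (ger0_norm (ltW bV)).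
by rewrite ler_pM2r ?exprn_gt0 // ger0_norm ?ler_pM2r //; lra.
Qed.

Lemma value_cvg_norm v : 1 < b -> (forall n, 0 <= v n <= D) ->
  cvgn [normed series (value_term b v)].
Proof.
move=> b1 hv; apply: series_le_cvg (value_bound_cvg b1) => n.
- exact: normr_ge0.
- exact: le_trans (normr_ge0 _) (value_term_le b1 (hv n)).
- exact: value_term_le.
Qed.

Lemma value_cvg v : 1 < b -> (forall n, 0 <= v n <= D) ->
  cvgn (series (value_term b v)).
Proof. by move=> b1 hv; apply: normed_cvg; exact: value_cvg_norm. Qed.

Lemma value_shift v : 1 < b -> (forall n, 0 <= v n <= D) ->
  value b (fun n => v n.+1) = 1 + (v 0)%:~R - b * value b v.
Proof.
move=> b1 hv; have hv' n : 0 <= v n.+1 <= D by [].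
have b0 : b != 0 by rewrite gt_eqF //; lra.
apply/(cvg_unique _ (value_cvg b1 hv')) => //.
have e n : series (value_term b (fun n => v n.+1)) n =
    1 + (v 0)%:~R - b * series (value_term b v) n.+1.
  have s0 w : series (value_term b w) 0 = 0 by rewrite /series /= big_geq.
  elim: n => [|n IH].
    by rewrite seriesSr !s0 /value_term; field.
  by rewrite seriesS IH [in RHS]seriesS /value_term exprS; field.
rewrite (_ : series _ = fun n => 1 + (v 0)%:~R - b * series (value_term b v) n.+1);
  last exact/funext.
apply: cvgB; first exact: cvg_cst.
apply: cvgMr.
have := value_cvg b1 hv; rewrite -cvg_shiftS; exact.
Qed.

Lemma value_bounded v : 1 < b -> (forall n, 0 <= v n <= D) ->
  `|value b v| <= limn (series bound).
Proof.
move=> b1 hv; apply: le_trans (lim_series_norm (value_cvg_norm b1 hv)) _.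
apply: lim_series_le => [||n]; first exact: value_cvg_norm.
  exact: value_bound_cvg b1.
exact: value_term_le.
Qed.

End Value.
End Dynamics.

(** * Transfer of expansions from one base to another *)

Section Transfer.
Variable R : realType.
Variables b b' : R.
Implicit Types (y u : R).

Lemma itin_bounds y n : 1 < b -> 0 < y <= 1 -> 0 <= itin b y n <= Num.floor b.
Proof.
move=> b1 /(iter_flipmap_itv b n) /andP[y0 y1]; rewrite digit_ge0 //=; last lra.
by apply: le_floor; rewrite -[leRHS]mulr1 ler_pM2l //; lra.
Qed.

Definition transfer y := value b' (itin b y).

Lemma transfer_flipmap y : 1 < b -> 1 < b' -> 0 < y <= 1 ->
  transfer (flipmap b y) = 1 + (digit b y)%:~R - b' * transfer y.
Proof.
move=> b1 b1' hy; rewrite /transfer -(value_shift b1' (fun n => itin_bounds n b1 hy)).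
by congr value; apply/funext => n; rewrite /itin -iterSr.
Qed.

Lemma transfer_follows y : 1 < b -> 1 < b' -> 0 < y <= 1 ->
  follows b' (itin b y) (fun n => transfer (iter n (flipmap b) y)).
Proof. by move=> b1 b1' hy n; exact: (transfer_flipmap b1 b1' (iter_flipmap_itv b n hy)). Qed.

Lemma transfer_bounded : 1 < b -> 1 < b' ->
  exists c, forall y, 0 < y <= 1 -> `|transfer y| <= c.
Proof.
move=> b1 b1'; eexists=> y hy.
exact: (value_bounded b1' (fun n => itin_bounds n b1 hy)).
Qed.

Lemma transfer_ge_of_le e : 1 < b -> 1 < b' ->
  (forall y, 0 < y <= 1 -> transfer y <= 1 + b' * e) ->
  forall y, 0 < y <= 1 -> - e <= transfer y.
Proof.
move=> b1 b1' le_e y hy; have := le_e _ (flipmap_itv b y).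
have d0 : 0 <= (digit b y)%:~R :> R.
  by rewrite ler0z digit_ge0 //; lra.
rewrite transfer_flipmap // => le.
rewrite -(ler_pM2l (lt_trans ltr01 b1')) mulrN; lra.
Qed.

(** Let [v] be the digit sequence of [y] and [j] the first place where it differs
    from the sequence [a'] of 1 in base [b'].  Since [v] is at most [a'], the
    digit [v j] differs from [a' j] by at least 1 in the direction that lowers
    the value, which compensates the size of the next point up to the excess
    [b' * e] (or [e] below 0); the excess is divided by [b' ^ j.+1]. *)
Lemma transfer_le_step e : 1 < b -> 1 < b' ->
  alt_le (itin b 1) (itin b' 1) -> 0 <= e ->
  (forall y, 0 < y <= 1 -> transfer y <= 1 + b' * e) ->
  forall y, 0 < y <= 1 -> transfer y <= 1 + e.
Proof.
move=> b1 b1' aa' e0 le_e y hy.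
have h1 : 0 < (1 : R) <= 1 by lra.
have ge_e := transfer_ge_of_le b1 b1' le_e.
have ya' : alt_le (itin b y) (itin b' 1).
  by apply: alt_le_trans aa'; apply: itin_mono; lra.
have fx := transfer_follows b1 b1' hy; have fx' := orbit_follows b' 1.
have hx n := iter_flipmap_itv b n hy.
have hx' n := iter_flipmap_itv b' n h1.
have [all_eq|[j agree ne]] := first_difference (itin b y) (itin b' 1).
  suff -> : transfer y = 1 by rewrite lerDl.
  apply: (follows_unique (c := 1 + b' * e + e) b1' fx fx' all_eq) => n.
  have be0 : 0 <= b' * e by rewrite mulr_ge0 //; lra.
  move: be0 (le_e _ (hx n)) (ge_e _ (hx n)) (hx' n).
  move: (transfer _) (iter _ _ 1) (b' * e) => s s' be.
  by rewrite ler_norml; lra.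
have {ya'} := ya' j agree.
have : transfer (iter j.+1 (flipmap b) y) - iter j.+1 (flipmap b') 1 =
   (itin b y j)%:~R - (itin b' 1 j)%:~R - b' * ((- b') ^+ j * (transfer y - 1)).
  by rewrite -(follows_diff fx fx' agree) fx fx'; ring.
move: (le_e _ (hx j.+1)) (ge_e _ (hx j.+1)) (hx' j.+1).
move: (transfer (iter _ _ _)) (iter _ _ 1) => s s' le_s ge_s hs'.
move: ne; rewrite /= exprNn -signr_odd.
move: (itin b y j) (itin b' 1 j) => d d' ne.
have grow t : 0 <= t -> b' * t <= b' * (b' ^+ j * t).
  by move=> t0; rewrite ler_pM2l ?ler_peMl ?exprn_ege1 //; lra.
move=> diff alt; rewrite leNgt; apply/negP => gt_x.
have {grow} big := grow (transfer y - 1) ltac:(lra).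
have gt_be : b' * e < b' * (transfer y - 1) by rewrite ltr_pM2l; lra.
have gt_e : e < b' * (transfer y - 1).
  by apply: lt_le_trans (_ : transfer y - 1 <= _); rewrite ?ler_peMl; lra.
move: (transfer y - 1) (b' * e) big gt_be gt_e le_s diff => t be.
rewrite -[_ * _ * t]mulrA; move: (b' ^+ j * t) => qt; clear gt_x.
case: odd alt => /= dd'; rewrite ?expr0 ?expr1 ?mulN1r ?mul1r ?mulrN.
  have {}dd' : d'%:~R + 1 <= d%:~R :> R.
    by apply: intr_lt_addr1; rewrite lt_neqAle eq_sym dd' andbT; apply/eqP.
  by move: (b' * t) (b' * qt) => ? ?; lra.
have {}dd' : d%:~R + 1 <= d'%:~R :> R.
  by apply: intr_lt_addr1; rewrite lt_neqAle dd' andbT; apply/eqP.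
by move: (b' * t) (b' * qt) => ? ?; lra.
Qed.

Lemma le1_of_exp (x c : R) : 1 < b' -> (forall n, x <= 1 + c / b' ^+ n) -> x <= 1.
Proof.
move=> b1' hx; rewrite leNgt; apply/negP => gt1.
have [n] := exp_unbounded (c / (x - 1)) b1'.
have q0 : 0 < b' ^+ n by rewrite exprn_gt0 //; lra.
rewrite ltr_pdivrMr; last lra.
have : b' ^+ n * x <= b' ^+ n * (1 + c / b' ^+ n) by rewrite ler_pM2l.
have -> : b' ^+ n * (1 + c / b' ^+ n) = b' ^+ n + c by field; rewrite gt_eqF.
by lra.
Qed.

Lemma transfer_itv y : 1 < b -> 1 < b' ->
  alt_le (itin b 1) (itin b' 1) -> 0 < y <= 1 -> 0 <= transfer y <= 1.
Proof.
move=> b1 b1' aa' hy; have [c hc] := transfer_bounded b1 b1'.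
have c0 : 0 <= c by apply: le_trans (normr_ge0 _) (hc _ hy).
have step n : forall y, 0 < y <= 1 -> transfer y <= 1 + c / b' ^+ n.
  elim: n => [|n IH] z hz.
    by rewrite expr0 divr1; have := hc _ hz; rewrite ler_norml; lra.
  apply: (transfer_le_step b1 b1' aa' _ _ hz) => [|w hw].
    by rewrite divr_ge0 // exprn_ge0 //; lra.
  suff -> : b' * (c / b' ^+ n.+1) = c / b' ^+ n by exact: IH.
  by rewrite exprS; field; rewrite expf_neq0 gt_eqF //; lra.
have le1 z : 0 < z <= 1 -> transfer z <= 1 + b' * 0.
  by rewrite mulr0 addr0 => hz; apply: le1_of_exp b1' _ => n; exact: step.
have := transfer_ge_of_le b1 b1' le1 hy; have := le1 _ hy.
by rewrite mulr0 oppr0 addr0 => -> ->.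
Qed.

(** From [u] with value 0 the next point [t = 1 - b * u] has value 1.  Follow [t]
    until its digits leave those of 1 in base [b'].  Up to there both have the
    same value, so this value lies on a boundary between two digits, and [t]
    takes the smaller one: its next value is again 0, while the orbit of 1 in
    base [b'] returns to 1.  Since [t] is at distance [b * u] from 1, expansion
    makes the new point at least [b * u].  If [a] leaves [a'] at the same place
    as [t], this is immediate; otherwise periodicity of [a'] forces the orbit of
    1 in base [b] to return to 1 as well. *)
Lemma transfer_zero_step u : 1 < b -> 1 < b' ->
  alt_le (itin b 1) (itin b' 1) -> 0 < u <= 1 -> transfer u = 0 ->
  exists2 u', 0 < u' <= 1 /\ transfer u' = 0 & b * u <= u'.
Proof.
move=> b1 b1' aa' hu Hu0.
have h1 : 0 < (1 : R) <= 1 by lra.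
have H_itv y : 0 < y <= 1 -> 0 <= transfer y <= 1 by exact: transfer_itv.
set t := flipmap b u; have ht : 0 < t <= 1 by exact: flipmap_itv.
have du : digit b u = 0.
  have := H_itv _ ht; rewrite /t transfer_flipmap // Hu0 mulr0 subr0.
  have d0 : 0 <= digit b u by apply: digit_ge0; lra.
  move=> /andP[_]; rewrite gerDl lerz0 => d1.
  by apply/eqP; rewrite eq_le d1.
have def_t : t = 1 - b * u by rewrite /t /flipmap du addr0.
have Ht1 : transfer t = 1.
  by rewrite /t transfer_flipmap // Hu0 du mulr0 subr0 addr0.
have bu0 : 0 < b * u by rewrite mulr_gt0 //; lra.
have ta : alt_le (itin b t) (itin b 1) by apply: itin_mono; lra.
have [all_eq|[j agree ne]] := first_difference (itin b t) (itin b' 1).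
  suff : t = 1 by lra.
  apply: itin_inj b1 ht h1 _ => i.
  by rewrite (alt_le_sandwich (n := i.+1) ta aa').
have ax := alt_le_sandwich ta aa' agree.
have fx := transfer_follows b1 b1' ht; have fx' := orbit_follows b' 1.
have := follows_diff fx fx' agree; rewrite [X in _ * (X - _)]Ht1 subrr mulr0.
move=> same.
have hx := H_itv _ (iter_flipmap_itv b j.+1 ht).
have hx' := iter_flipmap_itv b' j.+1 h1.
have next : transfer (iter j.+1 (flipmap b) t) - iter j.+1 (flipmap b') 1 =
    (itin b t j)%:~R - (itin b' 1 j)%:~R.
  by rewrite fx fx'; move/subr0_eq: same => ->; ring.
have jump : itin b' 1 j = itin b t j + 1.
  have : itin b t j - itin b' 1 j < 1 by rewrite -(ltr_int R) intrB; lra.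
  have : -1 <= itin b t j - itin b' 1 j by rewrite -(ler_int R) intrB; lra.
  move: (itin b t j) (itin b' 1 j) ne; clear; lia.
have {next} [Hu' orb'] : transfer (iter j.+1 (flipmap b) t) = 0 /\
    iter j.+1 (flipmap b') 1 = 1 :> R.
  by move: next; rewrite jump intrD; lra.
(* At odd [j] a smaller digit would make the sequence of [t] larger than [a']. *)
have even_j : ~~ odd j.
  apply/negP => odd_j; have := alt_le_trans ta aa' agree.
  by rewrite /= odd_j /= jump gerDl.
exists (iter j.+1 (flipmap b) t); first by split=> //; exact: iter_flipmap_itv.
have diff : iter j (flipmap b) 1 - iter j (flipmap b) t = b ^+ j * (b * u).
  rewrite (follows_diff (orbit_follows b 1) (orbit_follows b t) ax) /=.
  by rewrite exprNn -signr_odd (negbTE even_j) mul1r def_t; ring.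
have big : b * u <= b ^+ j.+1 * (b * u).
  by rewrite ler_peMl ?exprn_ege1 //; lra.
have diffS : iter j.+1 (flipmap b) 1 - iter j.+1 (flipmap b) t =
    (itin b 1 j)%:~R - (itin b t j)%:~R - b ^+ j.+1 * (b * u).
  rewrite (orbit_follows b 1) (orbit_follows b t) exprS -mulrA -diff; ring.
have hw := iter_flipmap_itv b j.+1 h1.
have ta_j : itin b t j <= itin b 1 j.
  by have := ta j (fun i lt => esym (ax i lt)); rewrite /= even_j.
have aa'_j : itin b 1 j <= itin b' 1 j.
  have := aa' j (fun i lt => etrans (ax i lt) (agree i lt)).
  by rewrite /= even_j.
have [e|e] : itin b 1 j = itin b t j \/ itin b 1 j = itin b' 1 j.
  by move: jump ta_j aa'_j; move: (itin b t j) (itin b 1 j) (itin b' 1 j); clear; lia.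

- by move: diffS; rewrite e; lra.
suff w1 : iter j.+1 (flipmap b) 1 = 1 :> R.
  by move: diffS; rewrite w1 e jump intrD; lra.
have agree_a i : (i < j.+1)%N -> itin b 1 i = itin b' 1 i.
  by rewrite ltnS leq_eqVlt => /predU1P[->//|lt]; rewrite ax // agree.
(* The common prefix has odd length and [a'] is periodic: removing it gives
   [a' <= w <= a <= a'], where [w] is the sequence of the orbit of 1 at [j.+1]. *)
have := alt_le_shift_odd (n := j.+1) even_j aa' agree_a.
rewrite (_ : (fun k => itin b' 1 (j.+1 + k)) = itin b' 1); last first.
  by apply/funext => k; rewrite itinD orb'.
rewrite (_ : (fun k => itin b 1 (j.+1 + k)) =
   itin b (iter j.+1 (flipmap b) 1)); last by apply/funext => k; rewrite itinD.
move=> a'w; have wa : alt_le (itin b (iter j.+1 (flipmap b) 1)) (itin b 1).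
  by apply: itin_mono; lra.
apply: itin_inj b1 hw h1 _ => i.
suff same_all : forall n i, (i < n)%N ->
    itin b 1 i = itin b (iter j.+1 (flipmap b) 1) i.
  by rewrite (same_all i.+1).
move=> n; apply: alt_le_sandwich wa (alt_le_trans aa' a'w) _.
by [].
Qed.

(** Repeating the expansion step from a point with value 0 would leave the
    domain. *)
Lemma transfer_gt0 y : 1 < b -> 1 < b' ->
  alt_le (itin b 1) (itin b' 1) -> 0 < y <= 1 -> 0 < transfer y <= 1.
Proof.
move=> b1 b1' aa' hy; have /andP[H0 ->] := transfer_itv b1 b1' aa' hy.
rewrite andbT lt_def H0 andbT; apply/eqP => Hy0.
have grow n : exists2 u, 0 < u <= 1 /\ transfer u = 0 & b ^+ n * y <= u.
  elim: n => [|n [u [hu Hu] le_u]]; first by exists y; rewrite // expr0 mul1r.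
  have [u' hu' le_u'] := transfer_zero_step b1 b1' aa' hu Hu.
  exists u' => //; apply: le_trans le_u'.
  by rewrite exprS -mulrA ler_pM2l //; lra.
have [n] := exp_unbounded y^-1 b1.
have [u [hu _] le_u] := grow n.
have y0 : 0 < y by lra.
by rewrite -[y^-1]mul1r ltr_pdivrMr // => lt1; lra.
Qed.

Lemma transfer_digit y : 1 < b -> 1 < b' ->
  alt_le (itin b 1) (itin b' 1) -> 0 < y <= 1 ->
  digit b' (transfer y) = digit b y.
Proof.
move=> b1 b1' aa' hy; have := transfer_gt0 b1 b1' aa' (flipmap_itv b y).
by rewrite transfer_flipmap // => h; apply: digit_unique; lra.
Qed.

Lemma transfer_conj y : 1 < b -> 1 < b' ->
  alt_le (itin b 1) (itin b' 1) -> 0 < y <= 1 ->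
  flipmap b' (transfer y) = transfer (flipmap b y).
Proof.
by move=> b1 b1' aa' hy; rewrite transfer_flipmap // /flipmap transfer_digit.
Qed.

End Transfer.

(** * Growth rate of the number of digit words *)

Section Counting.
Variable R : realType.
Implicit Types (b y z : R) (n m : nat) (s : seq R).

Fixpoint word b n y : seq int :=
  if n is n'.+1 then digit b y :: word b n' (flipmap b y) else [::].

Lemma wordD b n m y : word b (n + m) y = word b n y ++ word b m (iter n (flipmap b) y).
Proof. by elim: n y => //= n IH y; rewrite IH -iterSr. Qed.

Lemma size_word b n y : size (word b n y) = n.
Proof. by elim: n y => //= n IH y; rewrite IH. Qed.

Lemma word_diff b n y z : word b n y = word b n z ->
  iter n (flipmap b) y - iter n (flipmap b) z = (- b) ^+ n * (y - z).
Proof.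
elim: n y z => [|n IH] y z; first by rewrite expr0 mul1r.
move=> [dyz /IH]; rewrite -!iterSr => ->.
by rewrite /flipmap dyz exprS; ring.
Qed.

Lemma word_convex b n y x z : 0 < b -> y <= x <= z ->
  word b n y = word b n z -> word b n x = word b n y.
Proof.
move=> b0; elim: n y x z => //= n IH y x z /andP[yx xz] [dyz eq_w].
have dxy : digit b x = digit b y.
  by apply/eqP; rewrite eq_le {1}dyz !digit_mono.
congr cons => //; rewrite eq_w; apply: IH (esym eq_w).
by rewrite /flipmap dxy -dyz !lerD2l !lerN2 !ler_pM2l // xz.
Qed.

(** The breakpoints are the discontinuities [k / b] of the digit, together with
    the preimages of the previous breakpoints under each affine branch. *)
Lemma breakpoints b m : 0 < b -> exists B : seq R, forall y z,
  0 < y <= 1 -> 0 < z <= 1 -> y < z -> word b m y != word b m z ->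
  exists2 c, c \in B & y <= c <= z.
Proof.
move=> b0; elim: m => [|m [B hB]]; first by exists [::].
have [K hK] : exists K : nat, Num.floor b < K%:Z.
  exists `|Num.floor b|.+1; lia.
have dK y : 0 < y <= 1 -> exists2 k : nat, (k < K)%N & digit b y = k%:Z.
  move=> hy; have d0 : 0 <= digit b y by apply: digit_ge0; lra.
  have dF : digit b y <= Num.floor b.
    by apply: le_floor; rewrite -[leRHS]mulr1 ler_pM2l //; lra.
  exists `|digit b y|%N; lia.
exists ([seq k%:R / b | k <- iota 0 K] ++
        [seq (1 + k%:R - c) / b | k <- iota 0 K, c <- B]).
move=> y z hy hz yz; rewrite /= eqseq_cons negb_and.
have [kz ltz dz] := dK z hz; have [ky lty dy] := dK y hy.
have [dyz /= ne|/= ne _] := eqVneq (digit b y) (digit b z).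
  have [||||c cB hc] := hB (flipmap b z) (flipmap b y).
  - exact: flipmap_itv.
  - exact: flipmap_itv.
  - by rewrite /flipmap dyz ltrD2l ltrN2 ltr_pM2l.
  - by rewrite eq_sym.
  exists ((1 + kz%:R - c) / b).
    rewrite mem_cat; apply/orP; right.
    by apply/allpairsP; exists (kz, c); rewrite mem_iota.
  move: hc; rewrite /flipmap dyz dz.
  by rewrite ler_pdivrMr // ler_pdivlMr // !(mulrC _ b) -pmulrn; lra.
exists (kz%:R / b).
  rewrite mem_cat; apply/orP; left.
  by apply/mapP; exists kz; rewrite // mem_iota.
have lt : digit b y < digit b z.
  by rewrite lt_def eq_sym ne digit_mono // ltW.
have {}lt : (digit b y)%:~R + 1 <= (digit b z)%:~R :> R.
  exact: intr_lt_addr1.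
have := digit_itv b y; have := digit_itv b z.
move: lt; rewrite dz -pmulrn => lt hz' hy'.
by rewrite ler_pdivrMr // ler_pdivlMr // !(mulrC _ b); lra.
Qed.

Lemma min_positive s : exists2 e, 0 < e & forall d, d \in s -> 0 < d -> e <= d.
Proof.
elim: s => [|a s [e e0 he]]; first by exists 1.
have [a0|a0] := ltP 0 a.
  exists (Num.min e a); first by rewrite lt_min e0.
  move=> d; rewrite inE => /predU1P[->|/he h] d0; rewrite ge_min ?lexx ?orbT //.
  by rewrite h.
exists e => // d; rewrite inE => /predU1P[->|/he //]; lra.
Qed.

(** Two disjoint intervals each contain a breakpoint, so the distance is at least
    the smallest gap between breakpoints. *)
Lemma four_point_gap b m : 0 < b -> exists2 e, 0 < e & forall w x y z,
  0 < w -> z <= 1 -> w < x -> x < y -> y < z ->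
  word b m w != word b m x -> word b m y != word b m z -> e <= z - w.
Proof.
move=> b0; have [B hB] := breakpoints m b0.
have [e e0 he] := min_positive [seq q - p | q <- B, p <- B].
exists e => // w x y z w0 z1 wx xy yz ne1 ne2.
have [||p pB hp] := hB w x _ _ wx ne1; [lra|lra|].
have [||q qB hq] := hB y z _ _ yz ne2; [lra|lra|].
have : e <= q - p by apply: he; [apply/allpairsP; exists (q, p)|lra].
lra.
Qed.

(** Words are counted through points that realize them. *)
Definition words_le b n (c : R) := forall s,
  {in s, forall y, 0 < y <= 1} -> uniq (map (word b n) s) -> (size s)%:R <= c.

Lemma words_le0 b : words_le b 0 1.
Proof. by move=> [|y [|z s]] //= _ _; rewrite ler_nat. Qed.

(** Cut the sorted list of points into consecutive groups of three steps.  A group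
    whose endpoints have different [n]-words contributes to the count at length
    [n], because equal [n]-words form an interval.  In any other group the [n]-th
    iterates are four monotone points with different [m]-words, so they span at
    least [e] and the group has length at least [e / b ^ n]; the total length is
    at most 1. *)
Lemma words_le_rec b m e n c : 0 < b -> 0 < e ->
  (forall w x y z,
    0 < w -> z <= 1 -> w < x -> x < y -> y < z ->
    word b m w != word b m x -> word b m y != word b m z -> e <= z - w) ->
  words_le b n c -> words_le b (n + m) (3 * (c + b ^+ n / e) + 3).
Proof.
move=> b0 e0 gap hc s0 hs0 uniq_s0.
pose s := sort <=%R s0.
have perm_s : perm_eq s s0 by rewrite /s perm_sort.
have hs : {in s, forall y, 0 < y <= 1}.
  by move=> y; rewrite (perm_mem perm_s) => /hs0.
have uniq_s : uniq (map (word b (n + m)) s).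
  by rewrite (perm_uniq (perm_map _ perm_s)).
rewrite -(perm_size perm_s).
have lt_s : sorted <%R s.
  by rewrite lt_sorted_uniq_le (map_uniq uniq_s) sort_le_sorted.
move: s hs uniq_s lt_s {perm_s} => s hs uniq_s lt_s.
pose f i := nth 0 s i.
have f_lt i j : (i < j)%N -> (j < size s)%N -> f i < f j.
  move=> ij js; rewrite /f.
  exact: (sorted_ltn_nth lt_trans 0 lt_s i j (ltn_trans ij js) js ij).
have f_itv i : (i < size s)%N -> 0 < f i <= 1 by move=> /(mem_nth 0)/hs.
have f_word i j : (i < j)%N -> (j < size s)%N ->
    word b (n + m) (f i) != word b (n + m) (f j).
  move=> ij js; have is_ := ltn_trans ij js.
  rewrite -!(nth_map 0 [::]) // nth_uniq ?size_map //; lia.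
pose N := ((size s).-1 %/ 3)%N.
have sN : (size s <= 3 * N + 3)%N by rewrite /N; lia.
have Ns i : (i < N)%N -> (3 * i + 3 < size s)%N by rewrite /N; lia.
pose g i := f (3 * i)%N.
pose change i := word b n (g i) != word b n (g i.+1).
have change_le : (count change (iota 0 N))%:R <= c.
  rewrite -size_filter -(size_map g); apply: hc => [y /mapP[i]|].
    rewrite mem_filter mem_iota => /andP[_ iN] ->; apply: f_itv.
    by have := Ns i; lia.
  rewrite -map_comp map_inj_in_uniq ?filter_uniq ?iota_uniq //.
  have inj i j : change i -> (i < j)%N -> (j < N)%N -> word b n (g i) <> word b n (g j).
    move=> ci ij jN eq; move/negP: ci; apply; apply/eqP/esym.
    apply: word_convex b0 _ eq; have := Ns j jN => js.
    apply/andP; split; first by apply/ltW/f_lt; lia.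
    have [->//|ne] := eqVneq i.+1 j.
    by apply/ltW/f_lt; lia.
  move=> i j; rewrite !mem_filter !mem_iota /= add0n => /andP[ci iN] /andP[cj jN] eq.
  have [ij|ji|//] := ltngtP i j; first by case: (inj i j ci ij jN).
  by case: (inj j i cj ji iN).
have long i : (i < N)%N -> ~~ change i -> 1 <= (g i.+1 - g i) * (b ^+ n / e).
  move=> iN /negPn/eqP same; have is_ := Ns i iN.
  have g3 : g i.+1 = f (3 * i + 3)%N by rewrite /g mulnS addnC.
  have same_k k : (k <= 3)%N -> word b n (f (3 * i + k)%N) = word b n (g i).
    move=> k3; apply: word_convex b0 _ same; rewrite g3.
    apply/andP; split.
      have [->|k0] := posnP k; first by rewrite addn0.
      by apply/ltW/f_lt; lia.
    have [->//|ne] := eqVneq k 3%N.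
    by apply/ltW/f_lt; lia.
  pose h k := iter n (flipmap b) (f (3 * i + k)%N).
  have h_itv k : (k <= 3)%N -> 0 < h k <= 1.
    by move=> k3; apply/iter_flipmap_itv/f_itv; lia.
  have h_word k l : (k < l)%N -> (l <= 3)%N -> word b m (h k) != word b m (h l).
    move=> kl l3; have := @f_word (3 * i + k)%N (3 * i + l)%N.
    have -> : (3 * i + k < 3 * i + l)%N by lia.
    have -> : (3 * i + l < size s)%N by lia.
    rewrite !wordD eqseq_cat ?size_word // !same_k //; last by lia.
    by rewrite eqxx /=; apply.
  have h_diff k l : (k < l)%N -> (l <= 3)%N ->
      h k - h l = (- b) ^+ n * (f (3 * i + k)%N - f (3 * i + l)%N).
    by move=> kl l3; apply: word_diff; rewrite !same_k //; lia.
  have f_lt3 k l : (k < l)%N -> (l <= 3)%N -> f (3 * i + k)%N < f (3 * i + l)%N.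
    by move=> kl l3; apply: f_lt; lia.
  have bn0 : 0 < b ^+ n by rewrite exprn_gt0.
  suff : e <= b ^+ n * (f (3 * i + 3)%N - f (3 * i + 0)%N).
    rewrite g3 /g addn0 mulrA ler_pdivlMr // mul1r mulrC; exact.
  have [even_n|odd_n] := boolP (~~ odd n).
    have h_lt k l : (k < l)%N -> (l <= 3)%N -> h k < h l.
      move=> kl l3; rewrite -subr_lt0 h_diff // exprNn -signr_odd (negbTE even_n).
      by rewrite mul1r pmulr_rlt0 // subr_lt0 f_lt3.
    have := gap (h 0) (h 1) (h 2) (h 3).
    have := h_diff 0 3 isT isT; rewrite exprNn -signr_odd (negbTE even_n) mul1r.
    move=> hd gp; have {gp} : e <= h 3 - h 0.
      apply: gp; rewrite ?h_lt ?h_word //.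
      - by have := h_itv 0 isT; lra.
      - by have := h_itv 3 isT; lra.
    by rewrite !mulrBr in hd *; lra.
  have h_lt k l : (k < l)%N -> (l <= 3)%N -> h l < h k.
    move=> kl l3; rewrite -subr_gt0 h_diff // exprNn -signr_odd (negPn odd_n).
    by rewrite expr1 mulN1r mulNr oppr_gt0 pmulr_rlt0 // subr_lt0 f_lt3.
  have := gap (h 3) (h 2) (h 1) (h 0).
  have := h_diff 0 3 isT isT; rewrite exprNn -signr_odd (negPn odd_n) expr1 mulN1r.
  move=> hd gp; have {gp} : e <= h 0 - h 3.
    apply: gp; rewrite ?h_lt // 1?eq_sym ?h_word //.
    - by have := h_itv 3 isT; lra.
    - by have := h_itv 0 isT; lra.
  by rewrite mulNr !mulrBr in hd *; lra.
have q0 : 0 <= b ^+ n / e by rewrite divr_ge0 ?exprn_ge0 ?ltW.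
have g_mono i : (i < N)%N -> g i <= g i.+1.
  by move=> /Ns is_; apply/ltW/f_lt; lia.
have long_le : (count (predC change) (iota 0 N))%:R <= b ^+ n / e.
  rewrite -sum1_count natr_sum.
  apply: (@le_trans _ _ (\sum_(0 <= i < N) (g i.+1 - g i) * (b ^+ n / e))).
    rewrite /index_iota subn0 [leRHS](bigID (predC change)) /= -[leLHS]addr0.
    apply: lerD.
      rewrite [leLHS]big_seq_cond [leRHS]big_seq_cond; apply: ler_sum => i.
      by rewrite mem_iota => /andP[/= iN ci]; apply: long.
    rewrite big_seq_cond; apply: sumr_ge0 => i.
    rewrite mem_iota => /andP[/= iN _].
    by rewrite mulr_ge0 // subr_ge0 g_mono.
  rewrite -mulr_suml telescope_sumr // -[leRHS]mul1r ler_wpM2r //.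
  have [->|N0] := posnP N; first by rewrite subrr.
  have sz : (3 * N < size s)%N by have := Ns N.-1; lia.
  have sz0 : (0 < size s)%N by lia.
  by have := f_itv _ sz; have := f_itv _ sz0; rewrite /g muln0; lra.
have total : N = (count change (iota 0 N) + count (predC change) (iota 0 N))%N.
  by rewrite count_predC size_iota.
have : (size s)%:R <= 3 * N%:R + 3 :> R by rewrite -natrM -natrD ler_nat.
by rewrite {1}total natrD; lra.
Qed.

(** With [m] chosen so that [r ^ m > 4], a step multiplies the bound by more than
    the factor 3 and leaves room for the term of order [b ^ n]. *)
Lemma words_le_exp b r : 1 < b -> b < r ->
  exists m c, (0 < m)%N /\ forall k, words_le b (k * m) (c * r ^+ (k * m)).
Proof.
move=> b1 br; have r1 : 1 < r by lra.
have b0 : 0 < b by lra.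
have [m hm] := exp_unbounded 4 r1.
have m0 : (0 < m)%N by case: m hm => //; rewrite expr0; lra.
have [e e0 gap] := four_point_gap m b0.
pose c := 3 / e + 3; have e3 : 0 <= 3 / e by rewrite divr_ge0 ?ltW.
have c3 : 3 <= c by rewrite /c; lra.
exists m, c; split=> //; elim=> [|k IH] s hs.
  by move=> us; apply: le_trans (words_le0 hs us) _; rewrite mul0n expr0; lra.
rewrite mulSn addnC => us.
apply: le_trans (words_le_rec b0 e0 gap IH hs us) _.
rewrite exprD; set q := r ^+ (k * m).
have bq : b ^+ (k * m) <= q by rewrite lerXn2r ?nnegrE //; lra.
have q1 : 1 <= q by apply: exprn_ege1; lra.
have h1 : 3 / e * b ^+ (k * m) <= 3 / e * q by rewrite ler_wpM2l.
have e_q : c * q = 3 / e * q + 3 * q by rewrite mulrDl.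
have -> : 3 * (c * q + b ^+ (k * m) / e) + 3 =
    3 * (c * q) + 3 / e * b ^+ (k * m) + 3 by field; rewrite gt_eqF.
have h2 : c * q * 4 <= c * q * r ^+ m.
  by rewrite ler_wpM2l ?ltW // mulr_gt0; lra.
rewrite [leRHS]mulrA; move: (3 / e * b ^+ _) (3 / e * q) (c * q) (_ * r ^+ m) h1 e_q h2.
by move=> *; lra.
Qed.

(** Equal [n]-words would put the [n]-th iterates at distance [b ^ n] times that of
    the points, while iterates are at distance less than 1. *)
Lemma grid_words b n N : 0 < b -> (N%:R <= b ^+ n) ->
  uniq [seq word b n (i.+1%:R / N%:R) | i <- iota 0 N].
Proof.
move=> b0 le_N; rewrite map_inj_in_uniq ?iota_uniq // => i j.
rewrite !mem_iota /= !add0n => iN jN.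
have N0 : 0 < N%:R :> R by rewrite ltr0n; lia.
move=> /word_diff diff.
have itvs k : (k < N)%N -> 0 < iter n (flipmap b) (k.+1%:R / N%:R : R) <= 1.
  move=> kN; apply: iter_flipmap_itv.
  by rewrite divr_gt0 ?ltr0Sn //= ler_pdivrMr // mul1r ler_nat.
have : `|iter n (flipmap b) (i.+1%:R / N%:R : R) - iter n (flipmap b) (j.+1%:R / N%:R)| < 1.
  by have := itvs i iN; have := itvs j jN; rewrite ltr_norml; lra.
rewrite diff -mulrBl !normrM normrX normrN (gtr0_norm b0) normfV (gtr0_norm N0).
rewrite mulrA ltr_pdivrMr // mul1r => lt.
have : `|i.+1%:R - j.+1%:R| < 1 :> R.
  rewrite -(ltr_pM2l N0) mulr1; apply: le_lt_trans lt.
  by rewrite ler_wpM2r.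
rewrite -2!natr1 opprD addrACA subrr addr0 !pmulrn -intrB -intr_norm ltrz1; lia.
Qed.

(** If [b' < b], the [b ^ n - 1] words of base [b] would all be words of base [b'],
    of which there are at most of order [r ^ n] with [r < b]. *)
Lemma le_of_alt_le b b' : 1 < b -> 1 < b' ->
  alt_le (itin b 1) (itin b' 1) -> b <= b'.
Proof.
move=> b1 b1' aa'; rewrite leNgt; apply/negP => lt_b.
pose r := (b + b') / 2.
have [||m [c [m0 hc]]] := @words_le_exp b' r; rewrite /r; [lra|lra|].
rewrite -/r in hc.
have word_transfer n y : 0 < y <= 1 -> word b' n (transfer b b' y) = word b n y.
  elim: n y => //= n IH y hy.
  by rewrite transfer_digit // transfer_conj // IH // flipmap_itv.
have growth k : b ^+ (k * m) <= c * r ^+ (k * m) + 1.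
  set n := (k * m)%N.
  have [N le_N lt_N] : exists2 N : nat, N%:R <= b ^+ n & b ^+ n < N%:R + 1.
    exists (Num.truncn (b ^+ n)).
      by rewrite truncn_le // exprn_ge0; lra.
    by rewrite natr1 truncnS_gt.
  have b0 : 0 < b by lra.
  have grid_itv i : i \in iota 0 N -> 0 < (i.+1%:R / N%:R : R) <= 1.
    rewrite mem_iota add0n /= => iN; have N0 : 0 < N%:R :> R by rewrite ltr0n; lia.
    by rewrite divr_gt0 ?ltr0Sn //= ler_pdivrMr // mul1r ler_nat.
  have := hc k [seq transfer b b' (i.+1%:R / N%:R) | i <- iota 0 N].
  rewrite size_map size_iota -/n => h; have {h} : N%:R <= c * r ^+ n.
    apply: h => [y /mapP[i /grid_itv hi ->]|]; first exact: transfer_gt0.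
    rewrite -map_comp (eq_in_map _ (fun i => word b n (i.+1%:R / N%:R)) _).1.
      exact: grid_words.
    by move=> i /grid_itv hi /=; apply: word_transfer.
  lra.
have r0 : 0 < r by rewrite /r; lra.
have br : 1 < b / r by rewrite ltr_pdivlMr // /r; lra.
have [k hk] := exp_unbounded (c + 1) br.
have q1 : 1 <= r ^+ (k * m) by apply: exprn_ege1; rewrite /r; lra.
have : (b / r) ^+ k <= (b / r) ^+ (k * m).
  by rewrite ler_weXn2l ?ltW // leq_pmulr.
have : (b / r) ^+ (k * m) <= c + 1.
  rewrite expr_div_n ler_pdivrMr ?mulrDl ?mul1r; last lra.
  by have := growth k; lra.
lra.
Qed.

End Counting.

Theorem theorem3 (R : realType) (beta beta' : R)
    (hbeta : 1 < beta) (hbeta' : 1 < beta') :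
  beta < beta' <->
  alt_lt (negbeta_expansion beta (- beta / (beta + 1)))
         (negbeta_expansion beta' (- beta' / (beta' + 1))).
Proof.
rewrite (funext (negbeta_expansion_itin hbeta)).
rewrite (funext (negbeta_expansion_itin hbeta')).
split=> [lt|lt].
  apply: contrapT => nlt.
  by have := le_of_alt_le hbeta' hbeta (alt_leNgt nlt); lra.
rewrite lt_def (le_of_alt_le hbeta hbeta' (alt_ltW lt)) andbT.
by apply: contra_notN (@alt_lt_irr (itin beta 1)) => /eqP e; rewrite e in lt *.
Qed.
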